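(* Let $1\le p\le n$, let $U\in St_p^n$ and let $1\leq i_1<\dots<i_p\leq n$ be the indexes of rows of $U$ that form a full rank $p\times p$ submatrix $\bar U$ of $U$; put $I_p=\{i_1,\dots,i_p\}$. Then the matrices $$\Lambda_{i'j'}U,\quad i',j'\in I_p,\ i'<j',\qquad\text{and}\qquad \Lambda_{i''j''}U,\quad i''\in I_p,\ j''\in\{1,\dots,n\}\setminus I_p,$$ form a basis for the tangent space $T_USt_p^n$.
   Context: $St_p^n=\{U\in\mathcal M_{n\times p}(\mathbb R)\mid U^TU=\mathbb I_p\}$ is the orthogonal Stiefel manifold, regarded as an embedded submanifold of $\mathcal M_{n\times p}(\mathbb R)$, so that $T_USt_p^n$ is a linear subspace of $\mathcal M_{n\times p}(\mathbb R)$. For $1\le i,j\le n$, $i\neq j$, $\Lambda_{ij}:=\mathbf e_i\otimes\mathbf e_j-\mathbf e_j\otimes\mathbf e_i\in\mathcal M_{n\times n}(\mathbb R)$, where $\mathbf e_1,\dots,\mathbf e_n$ is the canonical basis of $\mathbb R^n$ and $\mathbf e_i\otimes\mathbf e_j$ is the $n\times n$ matrix with $1$ in row $i$, column $j$ and $0$ elsewhere. *)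

(* Defs.v *)
From mathcomp Require Import all_boot all_order all_algebra.
From mathcomp Require Import all_classical all_reals all_analysis.

Set Implicit Arguments.
Unset Strict Implicit.
Unset Printing Implicit Defensive.

Import Order.TTheory GRing.Theory Num.Theory.
Import numFieldNormedType.Exports.

Local Open Scope ring_scope.
Local Open Scope classical_set_scope.

Definition stiefel (R : realType) (n p : nat) : set 'M[R]_(n, p) :=
  [set U | U^T *m U = 1%:M].
Arguments stiefel : clear implicits.

(* The tangent space at U of an embedded submanifold M of a normed space V,
   as a subset of V: the velocities at 0 of the smooth curves in M through U.
   Curves are germs at 0: only their values near 0 matter. *)
Definition tangent_space (R : realType) (V : normedModType R)
    (M : set V) (U : V) : set V :=
  [set X | exists gamma : R -> V,
     [/\ \forall t \near (0 : R),
           M (gamma t) /\ forall k : nat, derivable (gamma^`(k)) t 1,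
         gamma 0 = U
       & gamma^`() 0 = X]].

(* The set T is a linear subspace of V, and X is a basis of it. *)
Definition is_basis (K : fieldType) (V : vectType K)
    (T : set V) (X : seq V) : Prop :=
  exists2 W : {vspace V}, (forall v, v \in W <-> T v) & basis_of W X.

Definition Lambda (R : realType) (n : nat) (i j : 'I_n) : 'M[R]_n :=
  delta_mx i j - delta_mx j i.

Definition tangent_family (R : realType) (n p : nat)
    (U : 'M[R]_(n, p)) (I : {set 'I_n}) : seq 'M[R]_(n, p) :=
  [seq Lambda R x.1 x.2 *m U | x : 'I_n * 'I_n in
     [pred x | [&& x.1 \in I, x.2 \in I & (x.1 < x.2)%N]]] ++
  [seq Lambda R x.1 x.2 *m U | x : 'I_n * 'I_n in
     [pred x | (x.1 \in I) && (x.2 \notin I)]].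

(* Main.v *)
(** The tangent space is the set of [X] with [U^T X] skew-symmetric: one
    inclusion differentiates [gamma^T gamma = 1]; for the other, such an [X] is
    [A U] with [A] skew-symmetric, and the Cayley transform of [t A / 2] applied
    to [U] is a rational curve without poles and with velocity [A U] at 0.
    The linear combinations of the given [Lambda i j] are the skew-symmetric
    [A] whose block outside [I] vanishes.  Using a left inverse [V] of [U] whose
    columns outside [I] are zero, [A] can be chosen of this shape, which gives
    spanning.  If such an [A] satisfies [A U = 0], then its rows outside [I] are
    supported in [I], hence vanish as [Ubar] is invertible; by skew symmetry all
    its rows are then supported in [I], so [A = 0], which gives freeness. *)
Require Import Defs.
From mathcomp Require Import all_boot all_order all_algebra.
From mathcomp Require Import all_classical all_reals all_analysis.
From mathcomp Require Import ring.

Set Implicit Arguments.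
Unset Strict Implicit.
Unset Printing Implicit Defensive.

Import Order.TTheory GRing.Theory Num.Theory.
Import numFieldNormedType.Exports.
Local Open Scope ring_scope.

(** * Derivatives of matrix-valued functions *)

Section MatrixDerivatives.
Local Open Scope classical_set_scope.
Variables (R : realType) (V : normedModType R).

Lemma is_derive_mxP (m n : nat) (M : V -> 'M[R]_(m, n)) (t v : V)
    (dM : 'M[R]_(m, n)) :
  is_derive t v M dM <-> forall i j, is_derive t v (fun x => M x i j) (dM i j).
Proof.
split=> [[dvM <-] i j|dMij].
  apply: DeriveDef; first by move/derivable_mxP: dvM; apply.
  by rewrite derive_mx // mxE.
have dvM : derivable M t v by apply/derivable_mxP => i j; case: (dMij i j).
apply: DeriveDef => //; rewrite derive_mx //; apply/matrixP => i j.
by rewrite mxE; case: (dMij i j).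
Qed.

Lemma is_derive_trmx (m n : nat) (M : V -> 'M[R]_(m, n)) (t v : V)
    (dM : 'M[R]_(m, n)) :
  is_derive t v M dM -> is_derive t v (fun x => (M x)^T) dM^T.
Proof.
move=> /is_derive_mxP dMij; apply/is_derive_mxP => i j; rewrite mxE.
by under eq_fun do rewrite mxE.
Qed.

Lemma is_derive_mulmx (m n p : nat) (F : V -> 'M[R]_(m, n)) (G : V -> 'M[R]_(n, p))
    (t v : V) (dF : 'M[R]_(m, n)) (dG : 'M[R]_(n, p)) :
  is_derive t v F dF -> is_derive t v G dG ->
  is_derive t v (fun x => F x *m G x) (dF *m G t + F t *m dG).
Proof.
move=> /is_derive_mxP dFij /is_derive_mxP dGij; apply/is_derive_mxP => i j.
under eq_fun do rewrite mxE.
have -> : (fun x => \sum_k F x i k * G x k j) =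
    \sum_(k < n) ((fun x => F x i k) * (fun x => G x k j)).
  by apply/funext => x; rewrite fct_sumE.
apply: is_derive_eq.
rewrite !mxE -big_split /=; apply: eq_bigr => k _.
by rewrite addrC [dF i k * _]mulrC.
Qed.

End MatrixDerivatives.

(** * Smoothness of rational matrix curves *)

Lemma is_derive_horner_quotient (R : realType) (P q : {poly R}) (t : R) :
  q.[t] != 0 ->
  is_derive t 1 (fun x => q.[x]^-1 * P.[x])
    ((q ^+ 2).[t]^-1 * (q * P^`() - q^`() * P).[t]).
Proof.
move=> q0.
have dV : is_derive t 1 (fun x => q.[x]^-1) (- q.[t] ^- 2 *: q^`().[t]).
  have dq : derivable (horner q) t 1 by exact: derivable_horner.
  by apply: DeriveDef; [exact: derivableV|rewrite deriveV// derive_val].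
have dP := is_derive_poly P t.
have -> : (fun x => q.[x]^-1 * P.[x]) = (fun x => q.[x]^-1) * horner P by [].
apply: is_derive_eq; rewrite !hornerE /GRing.scale /=.
by field.
Qed.

Lemma is_derive_horner_quotient_mx (R : realType) (m n : nat) (q : {poly R})
    (P : 'M[{poly R}]_(m, n)) (t : R) :
  q.[t] != 0 ->
  is_derive t 1 (fun x => q.[x]^-1 *: map_mx (horner_eval x) P)
    ((q ^+ 2).[t]^-1 *:
      map_mx (horner_eval t) (q *: map_mx (@deriv R) P - q^`() *: P)).
Proof.
move=> q0; apply/is_derive_mxP => i j.
under eq_fun do rewrite !mxE.
by rewrite !mxE; exact: is_derive_horner_quotient.
Qed.

(** The derivative is again a polynomial matrix over a polynomial, and its denominator [q ^+ 2] has
    no zero either; hence the induction on [k] generalizes over [q] and [P]. *)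
Lemma horner_quotient_smooth (R : realType) (m n : nat) (q : {poly R})
    (P : 'M[{poly R}]_(m, n)) (k : nat) (t : R) :
  (forall x, q.[x] != 0) ->
  derivable (derive1n k (fun x => q.[x]^-1 *: map_mx (horner_eval x) P)) t 1.
Proof.
move=> q0; elim: k q P q0 => [|k IHk] q P q0.
  by rewrite derive1n0; case: (is_derive_horner_quotient_mx P (q0 t)).
rewrite derive1Sn.
have -> : derive1 (fun x => q.[x]^-1 *: map_mx (horner_eval x) P) =
    fun x => (q ^+ 2).[x]^-1 *:
      map_mx (horner_eval x) (q *: map_mx (@deriv R) P - q^`() *: P).
  apply/funext => x; rewrite derive1E.
  by case: (is_derive_horner_quotient_mx P (q0 x)).
by apply: IHk => x; rewrite horner_exp expf_neq0.
Qed.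

(** * The Cayley transform of a skew-symmetric matrix *)

Section Cayley.
Variables (R : realType) (n : nat).
Implicit Types (S H : 'M[R]_n).

Lemma skew_mulmx_tr (v : 'rV[R]_n) S : S^T = - S -> v *m S *m v^T = 0.
Proof.
move=> skS; apply/matrixP => i j; rewrite !ord1 [RHS]mxE.
have /matrixP/(_ 0 0) : (v *m S *m v^T)^T = - (v *m S *m v^T).
  by rewrite !trmx_mul trmxK skS mulNmx mulmxN mulmxA.
rewrite [LHS]mxE [RHS]mxE => /eqP.
by rewrite -addr_eq0 -mulr2n mulrn_eq0 => /eqP.
Qed.

Lemma mulmx_tr_eq0 (v : 'rV[R]_n) : v *m v^T = 0 -> v = 0.
Proof.
move=> /matrixP/(_ 0 0); rewrite !mxE => /eqP.
rewrite psumr_eq0 => [/allP v0|k _]; last by rewrite mxE -expr2 sqr_ge0.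
apply/rowP => k; have := v0 k (mem_index_enum k).
by rewrite !mxE mulf_eq0 orbb => /eqP.
Qed.

(** If [v = v *m S], then [v *m v^T = v *m S *m v^T], which vanishes by skew symmetry, so
    [v = 0]. *)
Lemma skew_unitmx S : S^T = - S -> 1%:M - S \in unitmx.
Proof.
move=> skS; rewrite -row_free_unit -kermx_eq0; apply/rowV0P => v /sub_kermxP.
rewrite mulmxBr mulmx1 => /eqP; rewrite subr_eq0 => /eqP vS.
by apply: mulmx_tr_eq0; rewrite {1}vS skew_mulmx_tr.
Qed.

Lemma comm_1subD S : (1%:M - S) *m (1%:M + S) = (1%:M + S) *m (1%:M - S).
Proof.
rewrite !mulmxDl !mulmxDr !mul1mx !mulmx1 mulNmx mulmxN.
by rewrite !addrA addrK subrK.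
Qed.

Definition cayley S := (1%:M + S) *m invmx (1%:M - S).

Lemma mul_1sub_cayley S : S^T = - S -> (1%:M - S) *m cayley S = 1%:M + S.
Proof. by move=> skS; rewrite mulmxA comm_1subD mulmxK // skew_unitmx. Qed.

(** Transposition exchanges [1 - S] and [1 + S], so the transpose is [(1 + S)^-1 (1 - S)], and
    [(1 - S) *m cayley S = 1 + S] cancels the inverse. *)
Lemma cayley_orthogonal S : S^T = - S -> (cayley S)^T *m cayley S = 1%:M.
Proof.
move=> skS; have uB := skew_unitmx skS.
have uD : 1%:M + S \in unitmx.
  by rewrite -[S]opprK; apply: skew_unitmx; rewrite raddfN /= skS.
have trB : (1%:M - S)^T = 1%:M + S by rewrite raddfB /= trmx1 skS opprK.
have trD : (1%:M + S)^T = 1%:M - S by rewrite raddfD /= trmx1 skS.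
rewrite {1}/cayley trmx_mul trmx_inv trB trD.
by rewrite -mulmxA mul_1sub_cayley // mulVmx.
Qed.

Definition cayley_curve H (t : R) := cayley (t *: H).

(** The inverse is written as adjugate over determinant in matrices of polynomials; the common
    denominator has no real zero because [1 - t H] is always invertible. *)
Lemma cayley_curve_quotient H (t : R) : H^T = - H ->
  let B := 1%:M - 'X *: map_mx polyC H in
  let P := (1%:M + 'X *: map_mx polyC H) *m \adj B in
  (\det B).[t] != 0 /\
  cayley_curve H t = (\det B).[t]^-1 *: map_mx (horner_eval t) P.
Proof.
move=> skH B P.
have skt : (t *: H)^T = - (t *: H) by rewrite linearZ /= skH scalerN.
have XH : map_mx (horner_eval t) ('X *: map_mx polyC H) = t *: H.
  apply/matrixP => i j.
  by rewrite !mxE /= /horner_eval hornerM hornerX hornerC.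
have BE : map_mx (horner_eval t) B = 1%:M - t *: H by rewrite map_mxB map_mx1 XH.
have dB : (\det B).[t] = \det (1%:M - t *: H) by rewrite -BE det_map_mx.
have uB := skew_unitmx skt.
split; first by rewrite dB -unitfE -unitmxE.
rewrite dB map_mxM map_mxD map_mx1 XH map_mx_adj BE /cayley_curve /cayley.
by rewrite /invmx uB scalemxAr.
Qed.

End Cayley.

(** * The tangent space of the Stiefel manifold *)

Section StiefelTangent.
Local Open Scope classical_set_scope.
Variables (R : realType) (n p : nat) (U : 'M[R]_(n, p)).

Lemma tangent_space_stiefel_skew (X : 'M[R]_(n, p)) :
  tangent_space (stiefel R n p) U X -> U^T *m X + X^T *m U = 0.
Proof.
move=> [gamma [ngamma g0 dg0]].
have dg : is_derive (0 : R) 1 gamma X.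
  apply: DeriveDef; last by rewrite -derive1E.
  by have [_ /(_ 0%N)] := nbhs_singleton ngamma.
have dgg := is_derive_mulmx (is_derive_trmx dg) dg.
(* The product is known to be [1%:M] only near 0, which suffices for its derivative there. *)
have d0 : is_derive (0 : R) 1 (fun t => (gamma t)^T *m gamma t) 0.
  have := is_derive_cst (1%:M : 'M[R]_p) (0 : R) 1.
  apply: near_eq_is_derive.
  by apply: filterS ngamma => t [].
by rewrite addrC -g0; case: dgg => _ <-; case: d0.
Qed.

Lemma skew_mulmx_tangent (A : 'M[R]_n) :
  stiefel R n p U -> A^T = - A -> tangent_space (stiefel R n p) U (A *m U).
Proof.
(* The Cayley curve of [H] has velocity [2 H] at 0, whence the factor one half. *)
move=> StU skA; pose H := 2^-1 *: A.
have skH : H^T = - H by rewrite /H linearZ /= skA scalerN.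
have skt t : (t *: H)^T = - (t *: H) by rewrite linearZ /= skH scalerN.
pose gamma t := cayley_curve H t *m U.
have g0 : gamma 0 = U.
  by rewrite /gamma /cayley_curve scale0r /cayley subr0 addr0 invmx1 !mul1mx.
have [q [P [q0 gE]]] : exists q (P : 'M[{poly R}]_(n, p)),
    (forall t, q.[t] != 0) /\
    gamma = fun t => q.[t]^-1 *: map_mx (horner_eval t) P.
  pose B := 1%:M - 'X *: map_mx polyC H.
  exists (\det B), ((1%:M + 'X *: map_mx polyC H) *m \adj B *m map_mx polyC U).
  split=> [t|]; first by have [] := cayley_curve_quotient t skH.
  apply/funext => t; rewrite /gamma.
  have [_ ->] := cayley_curve_quotient t skH.
  rewrite -scalemxAl [in RHS]map_mxM; congr (_ *: (_ *m _)).
  by apply/matrixP => i j; rewrite !mxE /= /horner_eval hornerC.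
have dg k t : derivable (derive1n k gamma) t 1.
  by rewrite gE; exact: horner_quotient_smooth.
exists gamma; split => //.
  near=> t; split=> [|k]; last exact: dg.
  rewrite /stiefel /= /gamma trmx_mul mulmxA -(mulmxA _ _ (cayley_curve H t)).
  by rewrite cayley_orthogonal // mulmx1.
(* Differentiate (1 - t H) gamma(t) = (1 + t H) U at 0. *)
have dtH : is_derive (0 : R) 1 (fun t => t *: H) H.
  apply/is_derive_mxP => i j.
  under eq_fun do rewrite mxE.
  have -> : (fun t : R => t * H i j) = id * cst (H i j) by [].
  by apply: is_derive_eq; rewrite scaler0 add0r [LHS]mulr1.
have dgamma : is_derive (0 : R) 1 gamma ('D_1 gamma 0).
  by apply: DeriveDef => //; exact: (dg 0%N).
have d1 := is_derive_cst (1%:M : 'M[R]_n) (0 : R) 1.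
have dL := is_derive_mulmx (is_deriveB d1 dtH) dgamma.
have dR := is_derive_mulmx (is_deriveD d1 dtH) (is_derive_cst U (0 : R) 1).
have eLR : (fun t => (cst 1%:M - *:%R^~ H) t *m gamma t) =
    (fun t => (cst 1%:M + *:%R^~ H) t *m cst U t).
  apply/funext => t.
  by rewrite /gamma mulmxA [X in X *m _ = _]mul_1sub_cayley.
rewrite eLR in dL.
(* [dL] and [dR] now concern the same function, so their values at 0 agree. *)
have : - H *m U + 'D_1 gamma 0 = H *m U.
  case: dL => _; case: dR => _ -> /=.
  rewrite g0 !fctE /= scale0r subr0 mul1mx mulmx0 addr0 !add0r.
  by move=> <-.
rewrite derive1E mulNmx => /eqP; rewrite addrC subr_eq => /eqP ->.
rewrite -mulmxDl /H -scalerDl.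
by rewrite (_ : 2^-1 + 2^-1 = 1) ?scale1r //; field.
Unshelve. all: by end_near. Qed.

End StiefelTangent.

(* [X V] sends [U] to [X]; subtracting the transpose of [X V] makes it
   skew-symmetric, and the last term restores the product with [U]. *)
Lemma skew_factorization (R : fieldType) (n p : nat) (U X : 'M[R]_(n, p))
    (V : 'M[R]_(p, n)) :
  V *m U = 1%:M -> U^T *m X + X^T *m U = 0 ->
  let A := X *m V - V^T *m X^T + V^T *m (X^T *m U) *m V in
  A^T = - A /\ A *m U = X.
Proof.
move=> VU skX A; split; last first.
  by rewrite /A !mulmxDl mulNmx -!mulmxA VU !mulmx1 addrNK.
have skM : (X^T *m U)^T = - (X^T *m U).
  by apply/eqP; rewrite -addr_eq0 trmx_mul trmxK skX.
have -> : A^T = V^T *m X^T - X *m V + V^T *m (X^T *m U)^T *m V.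
  rewrite /A raddfD raddfB /= [(V^T *m _ *m V)^T]trmx_mul.
  by rewrite ![(V^T *m _)^T]trmx_mul [(X *m V)^T]trmx_mul !trmxK mulmxA.
by rewrite skM mulmxN mulNmx /A opprD opprB.
Qed.

Lemma tangent_space_stiefelP (R : realType) (n p : nat) (U X : 'M[R]_(n, p)) :
  stiefel R n p U ->
  tangent_space (stiefel R n p) U X <-> U^T *m X + X^T *m U = 0.
Proof.
move=> StU; split=> [|skX]; first exact: tangent_space_stiefel_skew.
(* The left inverse of [U] is here [U^T], since [StU] unfolds to [U^T *m U = 1%:M]. *)
have [skA <-] := skew_factorization StU skX.
exact: skew_mulmx_tangent.
Qed.

(** Freeness with coefficients indexed by the elements of [s] instead of positions, so that pairs of
    indices can serve as labels. *)
Lemma free_mapP (K : fieldType) (V : vectType K) (T : eqType) (f : T -> V)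
    (s : seq T) :
  uniq s ->
  (forall c : T -> K, \sum_(x <- s) c x *: f x = 0 -> {in s, forall x, c x = 0}) ->
  free [seq f x | x <- s].
Proof.
case: s => [|x0 s]; first by rewrite nil_free.
set r := x0 :: s => ur r0; suff: free (map_tuple f (in_tuple r)) by [].
apply/freeP => k k0 i.
(* Outside [r] the index is [size r], so [insub] fails and the default 0 is taken. *)
pose c x := oapp k 0 (insub (index x r)).
have cE (j : 'I_(size r)) : c (nth x0 r j) = k j.
  by rewrite /c index_uniq // valK.
rewrite -cE; apply: r0; last exact: mem_nth.
rewrite (big_nth x0) big_mkord -[RHS]k0; apply: eq_bigr => j _.
by rewrite cE /= -(nth_map x0 0 f).
Qed.

(** * Coordinates with respect to the matrices [Lambda i j] *)

Section LambdaCoordinates.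
Variables (R : realType) (n : nat).

Lemma sum_Lambda_entry (s : seq ('I_n * 'I_n)) (c : 'I_n * 'I_n -> R)
    (a b : 'I_n) :
  uniq s ->
  (\sum_(x <- s) c x *: Lambda R x.1 x.2) a b =
    (if (a, b) \in s then c (a, b) else 0) -
    (if (b, a) \in s then c (b, a) else 0).
Proof.
move=> us.
(* Each [Lambda] is a difference of two Kronecker deltas, and each delta selects one coefficient. *)
have pick y :
    \sum_(x <- s) c x * (x == y)%:R = if y \in s then c y else 0.
  case: ifP => [sy|/negbT sy]; last first.
    rewrite big_seq big1 // => x sx; case: eqP => [xy|]; last by rewrite mulr0.
    by rewrite -xy sx in sy.
  rewrite (bigD1_seq y) //= eqxx mulr1 big1 ?addr0 // => x /negPf ->.
  by rewrite mulr0.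
rewrite -!pick summxE -sumrB; apply: eq_bigr => -[x1 x2] _.
rewrite !mxE /= mulrBr !xpair_eqE.
by rewrite ![_ == x1]eq_sym ![_ == x2]eq_sym [(x2 == a) && _]andbC.
Qed.

(** For [a != b] not both outside [I], exactly one of [(a, b)] and [(b, a)] is listed; no other pair
    is. *)
Definition skew_index (I : {set 'I_n}) : seq ('I_n * 'I_n) :=
  enum [pred x : 'I_n * 'I_n | [&& x.1 \in I, x.2 \in I & (x.1 < x.2)%N]] ++
  enum [pred x : 'I_n * 'I_n | (x.1 \in I) && (x.2 \notin I)].

Lemma mem_skew_index (I : {set 'I_n}) (a b : 'I_n) :
  ((a, b) \in skew_index I) = (a \in I) && ((b \notin I) || (a < b)%N).
Proof.
rewrite mem_cat !mem_enum !inE /=.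
by case: (a \in I); case: (b \in I) => //=; rewrite orbF.
Qed.

Lemma skew_index_uniq (I : {set 'I_n}) : uniq (skew_index I).
Proof.
rewrite cat_uniq !enum_uniq andbT; apply/hasPn => x.
by rewrite !mem_enum !inE => /andP[_ /negPf ->]; rewrite andbF.
Qed.

Lemma tangent_familyE (p : nat) (U : 'M[R]_(n, p)) (I : {set 'I_n}) :
  tangent_family U I = [seq Lambda R x.1 x.2 *m U | x <- skew_index I].
Proof. by rewrite map_cat. Qed.

Lemma Lambda_decomposition (I : {set 'I_n}) (A : 'M[R]_n) :
  A^T = - A -> (forall a b, a \notin I -> b \notin I -> A a b = 0) ->
  A = \sum_(x <- skew_index I) A x.1 x.2 *: Lambda R x.1 x.2.
Proof.
move=> skA A0.
have Asym a b : A b a = - A a b by have /matrixP/(_ a b) := skA; rewrite !mxE.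
have Adiag a : A a a = 0.
  by apply/eqP; have /eqP := Asym a a; rewrite -addr_eq0 -mulr2n mulrn_eq0.
apply/matrixP => a b; rewrite sum_Lambda_entry ?skew_index_uniq //=.
rewrite !mem_skew_index.
rewrite [A b a]Asym.
have [aI|aI] := boolP (a \in I); have [bI|bI] := boolP (b \in I) => /=.
- by case: ltngtP => [||/val_inj <-]; rewrite ?subr0 ?sub0r ?opprK ?Adiag.
- by rewrite subr0.
- by rewrite sub0r opprK.
- by rewrite A0 // subr0.
Qed.

End LambdaCoordinates.

(** * Freeness and spanning from the invertible submatrix *)

Section FullRankRows.
Variables (R : realType) (n p : nat) (U : 'M[R]_(n, p)) (i : 'I_p -> 'I_n).
Hypotheses (i_inj : injective i) (Ubar_full : \rank (rowsub i U) = p).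
Let I := (i @: [set: 'I_p])%SET.

Let Ubar_unit : rowsub i U \in unitmx.
Proof. by rewrite -row_free_unit /row_free Ubar_full. Qed.

(** Left multiplication by [rowsub i 1%:M] extracts the chosen rows of [U], and then their square
    matrix is inverted. *)
Lemma left_inverse_supported :
  exists2 V : 'M[R]_(p, n), V *m U = 1%:M & forall k j, j \notin I -> V k j = 0.
Proof.
exists (invmx (rowsub i U) *m rowsub i 1%:M) => [|k j jI].
  by rewrite -mulmxA -rowsubE mulVmx.
rewrite mxE big1 // => l _; rewrite !mxE.
  case: eqP => [il|]; last by rewrite mulr0.
by rewrite -il imset_f in jI.
Qed.

Lemma supported_row_eq0 (v : 'rV[R]_n) :
  (forall j, j \notin I -> v 0 j = 0) -> v *m U = 0 -> v = 0.
Proof.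
(* Through this factorization [v *m U] becomes a row vector times [rowsub i U], which can be
   cancelled. *)
move=> v0 vU; have vE : v = (\row_k v 0 (i k)) *m rowsub i 1%:M.
  apply/rowP => j; rewrite mxE.
  have [/imsetP[k _ ->]|jI] := boolP (j \in I).
    rewrite (bigD1 k) //= big1 ?addr0 => [|l lk]; rewrite !mxE ?eqxx ?mulr1 //.
    by rewrite (inj_eq i_inj) (negPf lk) mulr0.
  rewrite v0 // big1 // => l _; rewrite !mxE.
  case: eqP => [il|]; last by rewrite mulr0.
  by rewrite -il imset_f in jI.
move: vU; rewrite vE -mulmxA -rowsubE => w0.
by rewrite -[\row__ _](mulmxK Ubar_unit) w0 !mul0mx.
Qed.

Lemma supported_skew_eq0 (A : 'M[R]_n) :
  A^T = - A -> (forall a b, a \notin I -> b \notin I -> A a b = 0) ->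
  A *m U = 0 -> A = 0.
Proof.
move=> skA A0 AU.
have Asym a b : A b a = - A a b by have /matrixP/(_ a b) := skA; rewrite !mxE.
have rowAU a : row a A *m U = 0 by rewrite -row_mul AU row0.
have A0r a : a \notin I -> row a A = 0.
  move=> aI; apply: supported_row_eq0 => // j jI.
  by rewrite mxE A0.
(* For [j] outside [I], [A a j] is minus an entry of the zero row [j], so every row is supported in
   [I]. *)
apply/row_matrixP => a; rewrite row0; apply: supported_row_eq0 => // j jI.
have /rowP/(_ a) := A0r j jI; rewrite !mxE => Aja.
by rewrite Asym Aja oppr0.
Qed.

Lemma tangent_family_free : free (tangent_family U I).
Proof.
rewrite tangent_familyE; apply: free_mapP => [|c c0 [a b] sab].
  exact: skew_index_uniq.
pose A := \sum_(x <- skew_index I) c x *: Lambda R x.1 x.2.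
have AE a' b' := sum_Lambda_entry c a' b' (skew_index_uniq I).
(* As [(b, a)] is not listed along with [(a, b)], the entry of [A] at [(a, b)] is exactly
   [c (a, b)]. *)
suff /matrixP/(_ a b) : A = 0.
  rewrite AE sab !mxE; suff /negPf -> : (b, a) \notin skew_index I by rewrite subr0.
  move: sab; rewrite !mem_skew_index => /andP[aI].
  by rewrite aI /=; case: (b \in I) => //= ab; rewrite -leqNgt ltnW.
apply: supported_skew_eq0.
- by apply/matrixP => a' b'; rewrite mxE [RHS]mxE !AE opprB.
- move=> a' b' aI bI.
  by rewrite AE !mem_skew_index (negPf aI) (negPf bI) subr0.
- rewrite mulmx_suml -[RHS]c0; apply: eq_bigr => x _.
  by rewrite scalemxAl.
Qed.

Lemma tangent_family_span (X : 'M[R]_(n, p)) :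
  U^T *m X + X^T *m U = 0 -> X \in <<tangent_family U I>>%VS.
Proof.
move=> skX; have [V VU V0] := left_inverse_supported.
have [skA AU] := skew_factorization VU skX.
set A := (X in X *m U = _) in AU; rewrite -AU (@Lambda_decomposition _ _ I A) //.
  rewrite mulmx_suml big_seq; apply: memv_suml => x sx.
  rewrite -scalemxAl memvZ // memv_span // tangent_familyE.
  by apply/mapP; exists x.
(* Every term of [A] has [V] as right factor or [V^T] as left factor, so it vanishes on the block
   outside [I]. *)
move=> a b aI bI.
have V0l m (B : 'M[R]_(m, p)) k : (B *m V) k b = 0.
  by rewrite mxE big1 // => l _; rewrite V0 ?mulr0.
rewrite /A mxE [X in X + _]mxE [X in _ + X + _]mxE !V0l addr0 add0r.
by rewrite mxE big1 ?oppr0 // => l _; rewrite mxE V0 ?mul0r.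
Qed.

End FullRankRows.

Theorem proposition2p1 (R : realType) (n p : nat) (p_gt0 : (1 <= p)%N)
    (p_le_n : (p <= n)%N) (U : 'M[R]_(n, p)) (U_St : stiefel R n p U)
    (i : 'I_p -> 'I_n)
    (i_incr : forall a b : 'I_p, (a < b)%N -> (i a < i b)%N)
    (Ubar_full : \rank (rowsub i U) = p) :
  is_basis (tangent_space (stiefel R n p) U)
           (tangent_family U (i @: [set: 'I_p])%SET).
Proof.
have i_inj : injective i.
  move=> a b iab; case: (ltngtP a b) => [/i_incr|/i_incr|/ord_inj //].
    by rewrite iab ltnn.
  by rewrite iab ltnn.
(* The tangent space becomes a [{vspace}] as the kernel of the linear map sending [X] to
   [U^T X + (U^T X)^T]. *)
pose L : 'Hom('M[R]_(n, p), 'M[R]_p) :=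
  linfun (mulmx U^T \+ (trmx \o mulmx U^T)).
pose W := lker L.
have memW X : (X \in W) <-> U^T *m X + X^T *m U = 0.
  by rewrite memv_ker lfunE /= trmx_mul trmxK; split=> /eqP.
exists W => [X|]; first by rewrite memW tangent_space_stiefelP.
rewrite /basis_of tangent_family_free // andbT eqEsubv; apply/andP; split.
  (* Each [Lambda i j] is skew-symmetric, so [U^T (Lambda + Lambda^T) U = 0]. *)
  apply/span_subvP => X; rewrite tangent_familyE => /mapP[x _ ->]; apply/memW.
  rewrite trmx_mul raddfB /= !trmx_delta -mulmxA -mulmxDr -mulmxDl.
  by rewrite -[X in _ + X]opprB subrr mul0mx mulmx0.
by apply/subvP => X /memW; exact: tangent_family_span.
Qed.
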